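(* Let $G$ be a finite group and $H$ a subgroup such that the interval $[H,G]$ is distributive and $|G:H| < 9720$. Then $[H,G]$ is linearly primitive.
   Context: For a subgroup $H$ of a finite group $G$, $[H,G]$ denotes the lattice of all subgroups $K$ with $H \subseteq K \subseteq G$, ordered by inclusion, with $K_1 \vee K_2 = \langle K_1, K_2\rangle$ and $K_1 \wedge K_2 = K_1 \cap K_2$. The interval is distributive if this lattice is distributive, i.e. $a \vee (b \wedge c) = (a\vee b)\wedge(a \vee c)$ for all $a,b,c$. For a representation $V$ of a group $G$ and a subgroup $H$, $V^H = \{v\in V \mid hv=v \ \forall h \in H\}$; for a subspace $X \subseteq V$, $G_{(X)} = \{g\in G \mid gx = x \ \forall x\in X\}$. An interval $[H,G]$ is called linearly primitive if there is an irreducible complex representation $V$ of $G$ such that $G_{(V^H)} = H$. *)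

(* Defs.v *)
From HB Require Import structures.
From mathcomp Require Import all_boot all_order all_algebra all_fingroup.
From mathcomp Require Import mxrepresentation.
From mathcomp Require Import reals complex.

Set Implicit Arguments.
Unset Strict Implicit.
Unset Printing Implicit Defensive.

Import GRing.Theory.

Local Open Scope group_scope.

Definition subgroup_interval (gT : finGroupType) (H G : {group gT}) :
    {set {group gT}} :=
  [set K : {group gT} | (H \subset K) && (K \subset G)].

Definition distributive_interval (gT : finGroupType) (H G : {group gT}) : Prop :=
  forall K1 K2 K3 : {group gT},
    K1 \in subgroup_interval H G ->
    K2 \in subgroup_interval H G ->
    K3 \in subgroup_interval H G ->
    K1 <*> (K2 :&: K3) = (K1 <*> K2) :&: (K1 <*> K3).

(* Matrix representations act on row vectors from the right, i.e. g sends v to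
   v *m rG g.  Replacing g by its inverse turns this into a left action with
   the same invariant subspaces, fixed vectors and pointwise stabilizers.
   The row space of [rfix_mx rG H] is V^H, and [rstab rG U] is the pointwise
   stabilizer in G of the row space of U. *)
Definition linearly_primitive (C : fieldType) (gT : finGroupType)
    (H G : {group gT}) : Prop :=
  exists (n : nat) (rG : mx_representation C G n),
    mx_irreducible rG /\ rstab rG (rfix_mx rG H) = H.

(* Main.v *)
Require Import Defs.
From mathcomp Require Import all_boot all_order all_algebra all_fingroup.
From mathcomp Require Import mxrepresentation.
From mathcomp Require Import reals complex.
From mathcomp Require Import pgroup boolp.

Set Implicit Arguments.
Unset Strict Implicit.
Unset Printing Implicit Defensive.

Import GRing.Theory Num.Theory.
Local Open Scope group_scope.

(** Every distributive interval [H, G] is linearly primitive over any field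
    whose characteristic does not divide |G|; representations are lifted one
    maximal step at a time along a chain from H up to G.

    Let M be maximal among the proper subgroups of K containing H, and let W be
    an irreducible representation of M, containing a nonzero H-fixed vector u,
    such that H is the stabilizer in M of W^H.  Every irreducible constituent V
    of the representation of K induced from W contains a copy of W, so the
    stabilizer L of V^H in K meets M in H.  If L differs from H, it is therefore
    a complement of M in [H, K], and in a distributive lattice such a complement
    is unique: when no constituent works, one and the same subgroup A <> H fixes
    the H-fixed vectors of all constituents, hence those of the whole induced
    representation.  But 1 (x) u is such a vector, and an element of K outside M
    moves it to another coset of M.

    The induced representation is never formed.  Everything takes place inside
    the regular representation of G, where W is made of vectors supported on M
    and an element outside M visibly moves the support of u
    ([support_mx_moved]).  By complete reducibility, some K-equivariant
    projection onto a simple module keeps u moved by a chosen element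
    ([simple_image_moved]), and the element is chosen in advance in all possible
    complements ([mem_every_complement]).  These combine in
    [isolating_submodule_step]. *)

(** * Complements in distributive intervals *)

(** This gives the uniqueness of complements.  The hypothesis distributes join
    over meet, and the proof needs the dual law A /\ (L \/ M) =
    (A /\ L) \/ (A /\ M), obtained by the usual double expansion. *)
Lemma trivial_meet_sub_supplement (gT : finGroupType) (G H A L M : {group gT}) :
  distributive_interval H G ->
  A \in subgroup_interval H G -> L \in subgroup_interval H G ->
  M \in subgroup_interval H G ->
  A :&: M = H -> A \subset L <*> M -> A \subset L.
Proof.
move=> distr intA intL intM tiAM sALM.
have /[!inE] /andP[sHA sAG] := intA; have /[!inE] /andP[sHL _] := intL.
have intAL : (A :&: L)%G \in subgroup_interval H G.
  by rewrite inE subsetI sHA sHL subIset ?sAG.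
have dual := distr _ _ _ intAL intA intM.
have join := distr _ _ _ intM intA intL.
apply/setIidPl/eqP; rewrite eqEsubset subsetIl /=.
suffices: A \subset (A :&: L) <*> (A :&: M).
  by rewrite tiAM (joing_idPl _) // subsetI sHA.
rewrite dual subsetI joing_subr /= joingC join subsetI joing_subr /=.
by rewrite joingC.
Qed.

(** The subgroups L are the complements of M in [H, K]: as M is maximal, L and M
    generate K as soon as L is not contained in M.  Uniqueness of the complement
    is what allows a single element a to serve for all of them. *)
Lemma mem_every_complement (gT : finGroupType) (G H K M : {group gT}) :
  distributive_interval H G -> H \subset M -> K \subset G ->
  [max M of N | N \proper K] ->
  exists2 a, a \in K :\: M &
    forall L : {group gT}, H \subset L -> L \subset K -> L :&: M = H ->
      L :!=: H -> a \in L.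
Proof.
move=> distr sHM sKG /maxgroupP[prMK maxM].
have sMK := proper_sub prMK.
pose compl (A : {group gT}) :=
  [&& H \subset A, A \subset K, A :&: M == H & A :!=: H].
have notM A : compl A -> ~~ (A \subset M).
  by case/and4P=> _ _ /eqP tiAM; apply: contra => /setIidPl <-; rewrite tiAM.
have int (A : {group gT}) :
    H \subset A -> A \subset K -> A \in subgroup_interval H G.
  by move=> sHA sAK; rewrite inE sHA (subset_trans sAK).
have [[A cA] | nocompl] := EM (exists A, compl A); last first.
  have /subsetPn[a Ka nMa] := proper_subn prMK.
  exists a; first by rewrite inE nMa.
  move=> L sHL sLK tiLM ntL; case: nocompl; exists L.
  by rewrite /compl sHL sLK tiLM eqxx.
have /subsetPn[a Aa nMa] := notM A cA.
have /and4P[sHA sAK /eqP tiAM _] := cA.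
exists a; first by rewrite inE nMa (subsetP sAK).
move=> L sHL sLK tiLM ntL.
have nLM : ~~ (L \subset M) by rewrite notM // /compl sHL sLK tiLM eqxx.
suffices sAL : A \subset L by apply: (subsetP sAL).
apply: trivial_meet_sub_supplement (distr) _ _ _ tiAM _; rewrite ?int //.
have sJK : L <*> M \subset K by rewrite join_subG sLK.
apply: contraR nLM => nsAJ.
have prJK : L <*> M \proper K.
  by rewrite properE sJK; apply: contra nsAJ => /(subset_trans sAK).
by rewrite -(maxM (L <*> M)%G prJK) ?joing_subl ?joing_subr.
Qed.

Local Open Scope ring_scope.

(** * Isolating a vector in a simple module *)

(** A vector whose two projections along a decomposition into submodules are
    both fixed by a is itself fixed, so one can keep splitting Y without losing
    the motion of u until the summand is simple.  Recording the projection p,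
    and not just V, carries submodules for smaller groups into V as well. *)
Lemma simple_image_moved (F : fieldType) (gT : finGroupType) (K : {group gT})
    n (rK : mx_representation F K n) (Y : 'M_n) (u : 'rV_n) (a : gT) :
  mxmodule rK Y -> mx_completely_reducible rK Y ->
  (u <= Y)%MS -> u *m rK a != u ->
  exists V p : 'M_n, [/\ mxsimple rK V, (V <= Y)%MS, (Y <= dom_hom_mx rK p)%MS,
    (Y *m p <= V)%MS & u *m p *m rK a != u *m p].
Proof.
have [r] := ubnP (\rank Y); elim: r Y u => // r IHr Y u ltYr modY redY Yu au.
have [simY | nsimY] := EM (mxsimple rK Y).
  by exists Y, 1%:M; split=> //; rewrite ?mulmx1 // scalar_mx_hom.
have nzY : Y != 0.
  apply: contraNneq au => Y0; move: Yu; rewrite Y0 submx0 => /eqP->.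
  by rewrite mul0mx.
have [U0 /and4P[modU0 sU0Y nzU0 ltU0Y]] : mxnonsimple rK Y.
  by have [//|irrY] := EM (mxnonsimple rK Y); case: nsimY; apply/mxsimpleP.
have [W0 modW0 defY dxUW] := redY U0 modU0 sU0Y.
have ltW0Y : (\rank W0 < \rank Y)%N.
  by rewrite -defY (mxdirectP dxUW) /= -[ltnLHS]add0n ltn_add2r lt0n mxrank_eq0.
have UW0 := mxdirect_addsP dxUW.
have WU0 : (W0 :&: U0 = 0)%MS by rewrite capmxC.
have project (U W : 'M_n) : mxmodule rK U -> mxmodule rK W ->
    (U + W :=: Y)%MS -> (U :&: W = 0)%MS -> (\rank U < \rank Y)%N ->
    u *m proj_mx U W *m rK a != u *m proj_mx U W ->
  exists V p : 'M_n, [/\ mxsimple rK V, (V <= Y)%MS, (Y <= dom_hom_mx rK p)%MS,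
    (Y *m p <= V)%MS & u *m p *m rK a != u *m p].
  move=> modU modW sumUW tiUW ltUY aU.
  have sUY : (U <= Y)%MS by rewrite -sumUW addsmxSl.
  have ltUr := leq_trans ltUY ltYr.
  have redU := mx_reducibleS modU sUY redY.
  have homY : (Y <= dom_hom_mx rK (proj_mx U W))%MS.
    by rewrite -sumUW proj_mx_hom.
  (* The definition of the projection as a product must stay hidden from the
     associativity rewrites below. *)
  have := proj_mx_sub U W.
  move: (proj_mx U W) homY aU => q /hom_mxP homY aU sqU.
  have [V [p [simV sVU homU pV ap]]] :=
    IHr U (u *m q) ltUr modU redU (sqU _ u) aU.
  have /hom_mxP homYq := submx_trans (sqU _ Y) homU.
  exists V, (q *m p); split; [exact: simV | exact: submx_trans sVU sUY | | |].
  - by apply/hom_mxP=> x Kx; rewrite !mulmxA homY // homYq.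
  - by rewrite mulmxA; apply: submx_trans pV; rewrite submxMr.
  by rewrite mulmxA.
have [aU | aW] : u *m proj_mx U0 W0 *m rK a != u *m proj_mx U0 W0
             \/ u *m proj_mx W0 U0 *m rK a != u *m proj_mx W0 U0.
- apply/orP; rewrite -negb_and; apply: contra au => /andP[/eqP aU /eqP aW].
  by rewrite -(add_proj_mx UW0 (_ : u <= U0 + W0)%MS) ?defY // mulmxDl aU aW.
- exact: project aU.
by apply: project aW => //; rewrite addsmxC.
Qed.

(** * Supports in the regular representation *)

Section Support.

Variables (F : fieldType) (gT : finGroupType) (G : {group gT}).
Local Notation aG := (regular_repr F G).

Lemma regular_coef m (U : 'M_(m, #|G|)) x i j : x \in G ->
  (U *m aG x) i j = U i (gring_index G (enum_val j * x^-1)%g).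
Proof.
move=> Gx; rewrite mxE (bigD1 (gring_index G (enum_val j * x^-1)%g)) //= big1.
  rewrite !mxE eqxx gring_indexK ?groupM ?groupV ?enum_valP // mulgKV.
  by rewrite gring_valK eqxx mulr1 addr0.
move=> k nkj; rewrite !mxE eqxx /=.
case: eqP => [jk | _]; last by rewrite mulr0.
case/eqP: nkj; rewrite jk gring_indexK ?groupM ?enum_valP //.
by rewrite mulgK gring_valK.
Qed.

Definition support_mx (A : {set gT}) : 'M[F]_#|G| :=
  diag_mx (\row_i (enum_val i \in A)%:R).

Lemma support_mxP m (U : 'M_(m, #|G|)) (A : {set gT}) :
  reflect (forall i j, enum_val j \notin A -> U i j = 0)
          (U <= support_mx A)%MS.
Proof.
apply: (iffP idP) => [/submxP[B ->] i j nAj | suppU].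
  by rewrite mul_mx_diag !mxE (negPf nAj) mulr0.
suffices ->: U = U *m support_mx A by apply: submxMl.
apply/matrixP=> i j; rewrite mul_mx_diag !mxE.
by have [_ | /suppU->] := boolP (enum_val j \in A); rewrite ?mulr1 ?mul0r.
Qed.

Lemma support_mxS (A B : {set gT}) :
  A \subset B -> (support_mx A <= support_mx B)%MS.
Proof.
move=> sAB; apply/support_mxP=> i j nBj.
have /support_mxP-> // := submx_refl (support_mx A).
by apply: contra nBj => /(subsetP sAB).
Qed.

(** These are the vectors of the group algebra of K inside that of G. *)
Lemma support_mx_module (K : {group gT}) (sKG : K \subset G) :
  mxmodule (subg_repr aG sKG) (support_mx K).
Proof.
apply/mxmoduleP=> x Kx; apply/support_mxP=> i j nKj.
have Gx := subsetP sKG x Kx.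
rewrite regular_coef //; have /support_mxP-> // := submx_refl (support_mx K).
by rewrite gring_indexK ?groupMr ?groupV ?enum_valP.
Qed.

(** Translation by a sends the support of u into the coset M a, disjoint
    from M. *)
Lemma support_mx_moved (M : {group gT}) (u : 'rV_#|G|) a :
  (u <= support_mx M)%MS -> u != 0 -> a \in G -> a \notin M -> u *m aG a != u.
Proof.
move=> /support_mxP suppu nzu Ga nMa; apply: contraNneq nMa => au.
have /rV0Pn[j nzj] := nzu.
have Mj : enum_val j \in M by apply: contraR nzj => /suppu->.
rewrite -(groupMl _ Mj); apply: contraR nzj => nMja.
have Gja : (enum_val j * a)%g \in G by rewrite groupM ?enum_valP.
have: (u *m aG a) 0 (gring_index G (enum_val j * a)%g) = 0.
  by rewrite au suppu ?gring_indexK.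
by rewrite regular_coef // gring_indexK // mulgK gring_valK => /eqP.
Qed.

End Support.

(** * Lifting along the interval *)

Section LinearPrimitivity.

Variables (F : fieldType) (gT : finGroupType) (G H : {group gT}).
Local Notation aG := (regular_repr F G).

(** Linear primitivity of [H, K], realized by a module inside the regular
    representation of G.  The support condition is what makes U behave like a
    submodule to be induced to larger groups, and the nonzero fixed vector, here
    required even when K = H, provides the vector to lift. *)
Definition isolating_submodule (K : {group gT}) (sKG : K \subset G) : Prop :=
  exists U : 'M[F]_#|G|,
    [/\ mxsimple (subg_repr aG sKG) U, (U <= support_mx F G K)%MS,
        (U :&: rfix_mx aG H)%MS != 0 &
        K :&: rstab aG (U :&: rfix_mx aG H)%MS = H].

(** The trivial module, spanned by the sum of the elements of H. *)
Lemma isolating_submodule_base (sHG : H \subset G) : isolating_submodule sHG.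
Proof.
pose u : 'rV[F]_#|G| := \row_j (enum_val j \in H)%:R.
have fixu : (u <= rfix_mx aG H)%MS.
  apply/rfix_mxP=> h Hh; have Gh := subsetP sHG h Hh.
  apply/rowP=> j; rewrite regular_coef // !mxE.
  by rewrite gring_indexK ?groupMr ?groupV ?enum_valP.
have nzu : u != 0.
  apply/rV0Pn; exists (gring_index G 1%g).
  by rewrite mxE gring_indexK // group1 oner_eq0.
have fixU : (<<u>> <= rfix_mx aG H)%MS by rewrite genmxE.
have defU : (<<u>> :&: rfix_mx aG H :=: <<u>>)%MS by apply: capmx_idPl.
exists <<u>>%MS; split.
- apply: linear_mxsimple; last by rewrite genmxE rank_rV nzu.
  by apply/mxmoduleP=> h Hh; rewrite (rfix_mxP H fixU).
- rewrite genmxE; apply/support_mxP=> i j nHj.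
  by rewrite mxE (negPf nHj).
- by rewrite (eqmx_eq0 defU) -mxrank_eq0 genmxE rank_rV nzu.
apply/setIidPl/subsetP=> h Hh; rewrite inE (subsetP sHG) //=.
by rewrite (rfix_mxP H (capmxSr _ _)).
Qed.

(** The restriction of p to W is M-equivariant and does not kill u, so it is
    injective as W is simple; this is the copy of W inside V. *)
Lemma isolating_submodule_step (M K : {group gT}) (sKG : K \subset G)
    (sMG : M \subset G) :
  [pchar F]^'.-group K -> distributive_interval H G -> H \subset M ->
  [max M of N | N \proper K] -> isolating_submodule sMG ->
  isolating_submodule sKG.
Proof.
move=> charK distr sHM maxM [W [simW suppW nzfixW stabW]].
have sMK : M \subset K by have /maxgroupP[/proper_sub] := maxM.
have sHK := subset_trans sHM sMK.
have [a /setDP[Ka nMa] complA] := mem_every_complement distr sHM sKG maxM.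
set B := (W :&: rfix_mx aG H)%MS in nzfixW stabW.
pose u := nz_row B.
have Bu : (u <= B)%MS := nz_row_sub B.
have nzu : u != 0 by rewrite nz_row_eq0.
have Wu : (u <= W)%MS := submx_trans Bu (capmxSl _ _).
have Ku := submx_trans suppW (support_mxS F G sMK).
have au : u *m aG a != u.
  by rewrite (support_mx_moved (submx_trans Wu suppW)) // (subsetP sKG).
have redK : mx_completely_reducible (subg_repr aG sKG) (support_mx F G K).
  apply: mx_reducibleS (support_mx_module F sKG) (submx1 _) _.
  exact: mx_Maschke_pchar.
have [V [p [simV sVK homp pV ap]]] :=
  simple_image_moved (support_mx_module F sKG) redK (submx_trans Wu Ku) au.
exists V; set N := (V :&: rfix_mx aG H)%MS.
have homB x m (D : 'M_(m, _)) : (D <= support_mx F G K)%MS -> x \in K ->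
    D *m aG x *m p = D *m p *m aG x.
  by move=> sDK Kx; have /hom_mxP/(_ x Kx) := submx_trans sDK homp.
have sBK : (B <= support_mx F G K)%MS := submx_trans (capmxSl _ _) Ku.
have BpN : (B *m p <= N)%MS.
  rewrite sub_capmx (submx_trans _ pV) ?submxMr //=.
  apply/rfix_mxP=> h Hh; rewrite -homB ?(subsetP sHK) //.
  by rewrite (rfix_mxP H (capmxSr _ _)).
have upN : (u *m p <= N)%MS by apply: submx_trans BpN; apply: submxMr.
have nzup : u *m p != 0 by apply: contraNneq ap => ->; rewrite mul0mx.
pose L := (K :&: rstab aG N)%G.
have sHL : H \subset L.
  rewrite subsetI sHK; apply/subsetP=> h Hh.
  by rewrite inE (subsetP sKG) ?(subsetP sHK) //= (rfix_mxP H (capmxSr _ _)).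
(* Schur: the kernel of p on W is a proper submodule of a simple module. *)
have injp : (W :&: kermx p = 0)%MS.
  have [modW _ irrW] := simW; apply/eqP; apply: contraNT nzup => nzker.
  have homW : (W <= dom_hom_mx (subg_repr aG sMG) p)%MS.
    by apply/hom_mxP=> x Mx; apply: homB => //; apply: (subsetP sMK).
  have := irrW _ (kermx_hom_module homW modW) (capmxSl _ _) nzker.
  move/(submx_trans Wu)/submx_trans/(_ (capmxSr _ _)).
  by move/sub_kermxP->.
(* The element x commutes with p and fixes the image of W^H under p; as p is
   injective on W, x already fixes W^H. *)
have tiLM : L :&: M = H.
  apply/eqP; rewrite eqEsubset subsetI sHL sHM !andbT.
  suffices: L :&: M \subset M :&: rstab aG B by rewrite stabW.
  apply/subsetP=> x /setIP[/setIP[Kx stabNx] Mx]; rewrite inE Mx inE.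
  rewrite (subsetP sKG) //= -subr_eq0 -submx0 -injp sub_capmx.
  have [modW _ _] := simW; have sBW : (B <= W)%MS := capmxSl _ _.
  rewrite addmx_sub ?eqmx_opp ?(mxmodule_trans modW Mx sBW) //=.
  by apply/sub_kermxP; rewrite mulmxBl homB // (rstab_act stabNx) // subrr.
split=> //; first by apply: contraNneq nzup => N0; rewrite -submx0 -N0.
apply/eqP; apply: contraNT ap => ntL; apply/eqP.
have /setIP[_ stabNa] := complA L sHL (subsetIl _ _) tiLM ntL.
exact: rstab_act stabNa upN.
Qed.

Lemma isolating_submodule_exists (K : {group gT}) (sKG : K \subset G) :
  [pchar F]^'.-group G -> distributive_interval H G -> H \subset K ->
  isolating_submodule sKG.
Proof.
move=> charG distr.
have [m] := ubnP #|K|; elim: m K sKG => // m IHm K sKG ltKm sHK.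
have [defH | neHK] := eqVneq (H :> {set gT}) K.
  have /val_inj defK := defH; move: (sKG); rewrite -defK => sHG.
  by have := isolating_submodule_base sHG.
have prHK : H \proper K by rewrite properEneq neHK.
have [M maxM sHM] :=
  @maxgroup_exists _ (fun N : {group gT} => N \proper K) H prHK.
have prMK : M \proper K by have /maxgroupP[] := maxM.
have sMG := subset_trans (proper_sub prMK) sKG.
apply: (@isolating_submodule_step M K sKG sMG _ distr sHM maxM).
  exact: pgroupS charG.
by apply: IHm => //; apply: leq_trans (proper_card prMK) _.
Qed.

Theorem distributive_linearly_primitive :
  [pchar F]^'.-group G -> distributive_interval H G -> H \subset G ->
  linearly_primitive F H G.
Proof.
move=> charG distr sHG.
have [U [simU _ _ stabU]] :=
  isolating_submodule_exists (subxx G) charG distr sHG.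
have {}simU : mxsimple aG U := simU.
have [modU _ _] := simU.
exists (\rank U), (submod_repr modU); split; first exact/submod_mx_irr.
rewrite (eqmx_rstab _ (rfix_submod modU sHG)) rstab_submod.
rewrite in_submodK ?capmxSl // -[RHS]stabU.
by apply/esym/setIidPr; apply: rstab_sub.
Qed.

End LinearPrimitivity.

Theorem theorem4p29 (R : realType) (gT : finGroupType) (G H : {group gT})
    (sHG : H \subset G)
    (distr : distributive_interval H G)
    (index_lt : (#|G : H|%g < 9720)%N) :
  linearly_primitive (complex R) H G.
Proof.
apply: distributive_linearly_primitive => //.
by rewrite /pgroup pcharf'_nat pnatr_eq0 -lt0n cardG_gt0.
Qed.
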